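(* Let the Hall–Littlewood parameter $t$ be scaled as $t=1-\varepsilon$, where $\varepsilon\searrow0$. Scale the discrete time as $\lfloor\varepsilon^{-1}\tau\rfloor$, where $\tau\in\mathbb{R}_{\ge0}$ is the new continuous time parameter. Under this (Poisson-type) scaling, the Hall–Littlewood noncolliding walks $\Upsilon_m^{\mathrm{HL}}$ on $\mathbb{W}_m$ turn into the continuous time Markov process $\Upsilon_m^{\mathrm{cont}}$ on $\mathbb{W}_m$.
   Context: Here $m\ge1$ is fixed, $\mathbb{W}_m$ is the set of integer vectors $\vec{\mathsf{x}}=(\mathsf{x}_1>\dots>\mathsf{x}_m\ge0)$ (configurations of $m$ particles on $\mathbb{Z}_{\ge0}$), and $\mathbf{1}_A$ is the indicator of $A$. For $0<t<1$, the Hall–Littlewood noncolliding walks are the discrete time Markov chain on $\mathbb{W}_m$ whose transition probabilities $\Upsilon_m^{\mathrm{HL}}$ are given, for $\vec{\mathsf{x}},\vec{\mathsf{y}}\in\mathbb{W}_m$ with $\mathsf{y}_i-\mathsf{x}_i\in\{-1,0\}$ for all $i$, by $$\Upsilon_m^{\mathrm{HL}}(\vec{\mathsf{x}},\vec{\mathsf{y}})=t^{-\binom m2}\left(t^{\mathsf{x}_m}\mathbf{1}_{\mathsf{y}_m=\mathsf{x}_m}+(1-t^{\mathsf{x}_m})\mathbf{1}_{\mathsf{y}_m=\mathsf{x}_m-1}\right)\prod_{i=1}^{m-1}\left(t^{\mathsf{x}_i}\mathbf{1}_{\mathsf{y}_i=\mathsf{x}_i}+t^{m-i}\mathbf{1}_{\mathsf{y}_i=\mathsf{x}_i-1}\right)\left(1-t^{\mathsf{x}_i-\mathsf{x}_{i+1}-1}\mathbf{1}_{\mathsf{y}_i=\mathsf{x}_i-1}\mathbf{1}_{\mathsf{y}_{i+1}=\mathsf{x}_{i+1}}\right),$$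 and are $0$ for all other $\vec{\mathsf{y}}\in\mathbb{W}_m$. The continuous time Markov process $\Upsilon_m^{\mathrm{cont}}$ on $\mathbb{W}_m$ has jump rates defined as follows. Attach to each particle $\mathsf{x}_i\in\mathbb{Z}_{\ge0}$, $i=1,\dots,m$, an independent exponential clock of rate $i(\mathsf{x}_i-\mathsf{x}_{i+1}-1)$, where by agreement $\mathsf{x}_{m+1}=-1$. When the clock of $\mathsf{x}_i$ rings, an index $j\in\{1,\dots,i\}$ is additionally selected uniformly at random, and all the particles $\mathsf{x}_i,\mathsf{x}_{i-1},\dots,\mathsf{x}_j$ simultaneously jump to the left by $1$. *)

(* Defs.v *)
From HB Require Import structures.
From mathcomp Require Import all_boot all_order all_algebra.
From mathcomp Require Import all_classical all_reals all_analysis.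
Set Implicit Arguments.
Unset Strict Implicit.
Unset Printing Implicit Defensive.
Import Order.TTheory GRing.Theory Num.Theory.
Import numFieldNormedType.Exports.
Local Open Scope classical_set_scope.
Local Open Scope ring_scope.

Definition config (m : nat) := {x : m.-tuple nat | sorted gtn x}.

(* Particles are numbered 1, ..., m, from the rightmost to the leftmost. The
   default value makes [part x m.+1 = -1]; [part x 0] is never used. *)
Definition part (m : nat) (x : config m) (i : nat) : int :=
  nth (-1) [seq Posz a | a <- sval x] i.-1.

Section Walks.
Context {R : realType} {m : nat}.
Implicit Types x y : config m.

(* [^] is the power with integer exponent; a boolean [b] enters a formula as
   the indicator [b%:R]. *)
Definition HL_weight (t : R) x y : R :=
  t ^ (- ('C(m, 2))%:Z)
  * (t ^ part x m * (part y m == part x m)%:R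
     + (1 - t ^ part x m) * (part y m == part x m - 1)%:R)
  * \prod_(1 <= i < m)
      ((t ^ part x i * (part y i == part x i)%:R
        + t ^ (m%:Z - i%:Z) * (part y i == part x i - 1)%:R)
       * (1 - t ^ (part x i - part x i.+1 - 1)
              * (part y i == part x i - 1)%:R
              * (part y i.+1 == part x i.+1)%:R)).

Definition HL_transition (t : R) x y : R :=
  if all (fun i => (part y i == part x i) || (part y i == part x i - 1))
         (iota 1 m)
  then HL_weight t x y else 0.

Definition clock_rate x (i : nat) : R :=
  (i%:Z * (part x i - part x i.+1 - 1))%:~R.

Definition block_jump (i j : nat) x y : bool :=
  all (fun k => part y k == if (j <= k <= i)%N then part x k - 1 else part x k)
      (iota 1 m).

Definition cont_rate x y : R :=
  \sum_(1 <= i < m.+1) \sum_(1 <= j < i.+1)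
    clock_rate x i * i%:R^-1 * (block_jump i j x y)%:R.

(* The state is left at the total rate of the clocks, since the particles move
   at every ring. *)
Definition cont_generator x y : R :=
  if x == y then - \sum_(1 <= i < m.+1) clock_rate x i else cont_rate x y.

End Walks.

Section MarkovProcesses.
Context {R : realType} {S : choiceType}.

Definition is_markov_chain (U : S -> S -> R) (d : measure_display)
    (T : measurableType d) (P : probability T R) (X : nat -> T -> S) : Prop :=
  (forall n a, measurable [set w | X n w = a]) /\
  (forall n (a : nat -> S),
     P [set w | forall k, (k <= n.+1)%N -> X k w = a k] =
     (P [set w | forall k, (k <= n)%N -> X k w = a k]
      * (U (a n) (a n.+1))%:E)%E).

Definition is_transition_function (p : R -> S -> S -> R) : Prop :=
  [/\ forall s a b, 0 <= s -> 0 <= p s a b,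
      forall s a, 0 <= s -> (\esum_(b in [set: S]) (p s a b)%:E = 1)%E,
      forall a b, p 0 a b = (a == b)%:R &
      forall s u a b, 0 <= s -> 0 <= u ->
        ((p (s + u) a b)%:E = \esum_(c in [set: S]) (p s a c * p u c b)%:E)%E].

(* [p h a b = 1_(a = b) + h * Q a b + o(h)] as [h] decreases to [0]. *)
Definition has_generator (p : R -> S -> S -> R) (Q : S -> S -> R) : Prop :=
  forall a b, (p h a b - (a == b)%:R) / h @[h --> 0^'+] --> Q a b.

(* [Y s] is only meaningful for [0 <= s]. *)
Definition is_markov_jump_process (Q : S -> S -> R) (d : measure_display)
    (T : measurableType d) (P : probability T R) (Y : R -> T -> S) : Prop :=
  (forall s a, 0 <= s -> measurable [set w | Y s w = a]) /\
  exists p : R -> S -> S -> R,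
    [/\ is_transition_function p,
        has_generator p Q &
        forall n (s : nat -> R) (a : nat -> S),
          0 <= s 0%N -> nondecreasing_seq s ->
          P [set w | forall k, (k <= n.+1)%N -> Y (s k) w = a k] =
          (P [set w | forall k, (k <= n)%N -> Y (s k) w = a k]
           * (p (s n.+1 - s n) (a n) (a n.+1))%:E)%E].

End MarkovProcesses.

(* Main.v *)
Require Import Defs.
From HB Require Import structures.
From mathcomp Require Import all_boot all_order all_algebra.
From mathcomp Require Import all_classical all_reals all_analysis.
From mathcomp Require Import lra zify ring.
Set Implicit Arguments.
Unset Strict Implicit.
Unset Printing Implicit Defensive.
Import Order.TTheory GRing.Theory Num.Theory.
Import numFieldNormedType.Exports.
Local Open Scope classical_set_scope.
Local Open Scope ring_scope.

(** Let U_e be the transition matrix of the walks for the parameter t = 1 - e,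
    and Q the generator of the jump process.  The whole argument rests on the
    expansion U_e = I + e Q + o(e), entry by entry, as e decreases to 0
    ([HL_generator]).  Write b_i for the indicator that the i-th particle moves,
    with the conventions b_(m+1) = 0 and x_(m+1) = -1.  Then an entry of U_e is
    t^(-binom(m,2)) times a product over i of t^(x_i) if b_i = 0, of t^(m-i) if
    b_i = b_(i+1) = 1, and of t^(m-i) (1 - t^(x_i - x_(i+1) - 1)) if b_i = 1 and
    b_(i+1) = 0.  The factors of the last kind, one for each maximal block of
    consecutive moving particles, are O(e), and the others tend to 1.  So the
    order 0 survives only if no particle moves, and the order 1 only if there is
    at most one block.  With one block j, ..., i the coefficient is
    x_i - x_(i+1) - 1, which is the rate of the i-th clock divided by the number
    i of choices of j; with no block it is binom(m,2) - sum x_i, which is minus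
    the sum of the rates of the clocks by Abel summation ([sum_clock_rate]).

    Particles only move to the left, so the configurations whose entries are at
    most M form a finite set F that neither process leaves.  This removes all
    questions of explosion and of uniqueness: no differential equation has to be
    solved, and the comparison is made as in the Lax and Chernoff theorems.
    Let p be the transition function of the jump process.  On F, both p(e) and
    U_e are I + e Q + o(e), so they differ by o(e), and p(n e) = p(e)^n differs
    from U_e^n by at most (1 + o(e))^n - 1, which tends to 0 when n e stays
    bounded ([restr_pow_dist], [restr_pow_cvg]).  The only infinite sum
    involved is the one in the Chapman-Kolmogorov identity; as p is stochastic,
    its part outside F is at most the mass 1 - sum_F p, which is o(e).

    Products of transition probabilities then give the convergence of the
    probability of each trajectory at the times 0, tau_1, ..., tau_k
    ([fdd_cvg]).  The trajectories form a countable set and the limits have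
    total mass 1, so the probability of every set of trajectories converges, by
    the argument of Scheffe ([pmf_cvg]). *)

(** * Sums over finite sequences *)

Lemma cvg_sum_seq (R : realType) (I : eqType) (r : seq I) (G : set_system R)
    (FG : Filter G) (f : I -> R -> R) (l : I -> R) :
  (forall i, i \in r -> f i h @[h --> G] --> l i) ->
  \sum_(i <- r) f i h @[h --> G] --> \sum_(i <- r) l i.
Proof.
elim: r => [_|i r IH fl].
  by under eq_fun do rewrite big_nil; rewrite big_nil; exact: cvg_cst.
under eq_fun do rewrite big_cons; rewrite big_cons.
apply: cvgD; first by apply: fl; rewrite inE eqxx.
by apply: IH => j jr; apply: fl; rewrite inE jr orbT.
Qed.

Lemma esum_seqID (R : realType) (S : choiceType) (f : S -> \bar R)
    (F : seq S) : uniq F -> (forall c, 0 <= f c)%E ->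
  (\esum_(c in [set: S]) f c =
   \sum_(c <- F) f c + \esum_(c in ~` [set` F]) f c)%E.
Proof.
move=> uF f0; rewrite (esumID [set` F])// !setTI; congr (_ + _)%E.
by rewrite (fsbig_seq _ _ uF) -esum_fset// set_mem_set.
Qed.

(** * Transition functions compared with powers of a matrix *)

(** The [n]-th power of the matrix of the [U a b], for [a] and [b] in [F]. *)
Fixpoint restr_pow (R : realType) (S : choiceType) (F : seq S) (U : S -> S -> R)
    (n : nat) (a b : S) : R :=
  if n is n'.+1 then \sum_(c <- F) U a c * restr_pow F U n' c b
  else (a == b)%:R.

Section TransitionFunction.
Context {R : realType} {S : choiceType} (p : R -> S -> S -> R).
Hypothesis pP : is_transition_function p.

Lemma transition_ge0 s a b : 0 <= s -> 0 <= p s a b.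
Proof. by case: pP => + _ _ _; apply. Qed.

Lemma transition_esum s a (F : seq S) : 0 <= s -> uniq F ->
  (\esum_(c in ~` [set` F]) (p s a c)%:E = (1 - \sum_(c <- F) p s a c)%:E)%E.
Proof.
move=> s0 uF; case: pP => _ /(_ s a s0) + _ _.
rewrite (esum_seqID uF) => [|c]; last by rewrite lee_fin transition_ge0.
rewrite sumEFin; case: (esum _ _) => [r||] //=.
  by rewrite -EFinD => -[<-]; rewrite addrAC subrr add0r.
Qed.

Lemma transition_sum_le1 s a (F : seq S) : 0 <= s -> uniq F ->
  \sum_(c <- F) p s a c <= 1.
Proof.
move=> s0 uF; rewrite -subr_ge0 -lee_fin -(transition_esum _ s0 uF).
by apply: esum_ge0 => c _; rewrite lee_fin transition_ge0.
Qed.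

Lemma transition_le1 s a b : 0 <= s -> p s a b <= 1.
Proof.
by move=> s0; have := @transition_sum_le1 s a [:: b] s0 isT; rewrite big_seq1.
Qed.

(** As [p u c b <= 1], the part of the Chapman-Kolmogorov sum outside [F] is at
    most the mass that [p s a] puts outside [F]. *)
Lemma chapman_kolmogorov_seq s u a b (F : seq S) : 0 <= s -> 0 <= u ->
    uniq F ->
  0 <= p (s + u) a b - \sum_(c <- F) p s a c * p u c b <=
  1 - \sum_(c <- F) p s a c.
Proof.
move=> s0 u0 uF; case: pP => _ _ _ /(_ s u a b s0 u0).
have pp0 c : (0 <= (p s a c * p u c b)%:E)%E.
  by rewrite lee_fin mulr_ge0 ?transition_ge0.
rewrite (esum_seqID uF)// sumEFin => pE.
have E0 : (0 <= \esum_(c in ~` [set` F]) (p s a c * p u c b)%:E)%E.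
  by apply: esum_ge0.
have E1 : (\esum_(c in ~` [set` F]) (p s a c * p u c b)%:E <=
           (1 - \sum_(c <- F) p s a c)%:E)%E.
  rewrite -transition_esum//; apply: le_esum => c _.
  by rewrite lee_fin ler_piMr ?transition_ge0// transition_le1.
move: pE E0 E1; case: (esum _ _) => [r||] //=.
by rewrite -EFinD !lee_fin => -[->] r0 r1; rewrite addrAC subrr add0r r0.
Qed.

(** The bound depends on [u - s] only; it comes from splitting off the term
    [c = a] of the Chapman-Kolmogorov sum for [u = (u - s) + s]. *)
Lemma transition_dist s u a b : 0 <= s -> s <= u ->
  `|p u a b - p s a b| <= 1 - p (u - s) a a.
Proof.
move=> s0 su; have us0 : 0 <= u - s by rewrite subr_ge0.
have := @chapman_kolmogorov_seq (u - s) s a b [:: a] us0 s0 isT.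
rewrite !big_seq1 subrK => /andP[r0 r1].
have := transition_le1 a a us0; have := transition_ge0 a b s0.
have := transition_le1 a b s0.
move: r0 r1; set x := p (u - s) a a; set y := p s a b; set z := p u a b.
move=> r0 r1 y1 y0 x1.
by rewrite ler_norml; apply/andP; split; nra.
Qed.

(** The errors of [n] successive steps add up: the first step is made with [U]
    in one term and with [p h - U] in the other, and the rows of [U], whose sums
    are at most [1 + k], turn the error [D] of the other steps into at most
    [(1 + k) D + k]. *)
Lemma restr_pow_dist (F : seq S) (U : S -> S -> R) (h k : R) :
    uniq F -> 0 <= h ->
    {in F &, forall a c, 0 <= U a c} ->
    {in F, forall a, \sum_(c <- F) U a c <= 1 + k} ->
    {in F, forall a, \sum_(c <- F) `|p h a c - U a c|
                     + (1 - \sum_(c <- F) p h a c) <= k} ->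
  forall n, {in F &, forall a b,
    `|p (n%:R * h) a b - restr_pow F U n a b| <= (1 + k) ^+ n - 1}.
Proof.
move=> uF h0 U0 U1 Uk; elim=> [|n IH] a b aF bF.
  by rewrite mul0r /=; case: pP => _ _ -> _; rewrite subrr normr0 expr0 subrr.
have nh0 : 0 <= n%:R * h by rewrite mulr_ge0.
have k0 : 0 <= k.
  apply: le_trans (Uk _ aF); rewrite addr_ge0 ?sumr_ge0//.
  by rewrite subr_ge0 transition_sum_le1.
have /andP[r0 r1] := @chapman_kolmogorov_seq h (n%:R * h) a b F h0 nh0 uF.
have -> : n.+1%:R * h = h + n%:R * h by rewrite -natr1 mulrDl mul1r addrC.
set r := p (h + _) a b - _ in r0 r1.
have -> : p (h + n%:R * h) a b - restr_pow F U n.+1 a b =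
    \sum_(c <- F) U a c * (p (n%:R * h) c b - restr_pow F U n c b)
    + (\sum_(c <- F) (p h a c - U a c) * p (n%:R * h) c b + r).
  rewrite addrA -big_split/= /r.
  rewrite [in RHS](eq_bigr (fun c => p h a c * p (n%:R * h) c b
    - U a c * restr_pow F U n c b)) => [|c _]; last by ring.
  by rewrite sumrB; ring.
apply: le_trans (ler_normD _ _) _.
have P1 : `|\sum_(c <- F) U a c * (p (n%:R * h) c b - restr_pow F U n c b)| <=
          (1 + k) * ((1 + k) ^+ n - 1).
  apply: le_trans (ler_norm_sum _ _ _) _.
  apply: (@le_trans _ _ (\sum_(c <- F) U a c * ((1 + k) ^+ n - 1))).
    rewrite big_seq [leRHS]big_seq; apply: ler_sum => c cF.
    by rewrite normrM ger0_norm ?U0// ler_wpM2l ?U0// IH.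
  rewrite -mulr_suml ler_wpM2r ?U1//.
  by rewrite subr_ge0 exprn_ege1// lerDl.
have P2 : `|\sum_(c <- F) (p h a c - U a c) * p (n%:R * h) c b + r| <= k.
  apply: le_trans (Uk _ aF); apply: le_trans (ler_normD _ _) _.
  rewrite (ger0_norm r0) lerD//; apply: le_trans (ler_norm_sum _ _ _) _.
  apply: ler_sum => c _; rewrite normrM ler_piMr//.
  by rewrite ger0_norm ?transition_ge0// transition_le1.
apply: le_trans (lerD P1 P2) _.
by rewrite exprS mulrBr mulr1; lra.
Qed.

End TransitionFunction.

Lemma near0_itv (R : realType) (r : R) : 0 < r ->
  \forall e \near 0^'+, 0 < e < r.
Proof.
move=> r0; near=> e; apply/andP; split; first by near: e; exact: nbhs_right_gt.
by near: e; exact: nbhs_right_lt.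
Unshelve. all: by end_near. Qed.

(** * The limit of the powers *)

Section Approximation.
Context {R : realType} {S : choiceType} (p : R -> S -> S -> R).
Hypothesis pP : is_transition_function p.
Context (Q : S -> S -> R).
Hypothesis pQ : has_generator p Q.

(** The modulus is [1 - p h a a], by [transition_dist]; it tends to 0 because of
    the generator. *)
Lemma transition_unif_cont s a b : 0 <= s -> forall e, 0 < e ->
  exists2 r, 0 < r & forall u, 0 <= u -> `|s - u| < r ->
    `|p s a b - p u a b| < e.
Proof.
move=> s0 e e0.
have h1 : p h a a @[h --> 0^'+] --> (1 : R).
  have H : (p h a a - 1) / h * h + 1 @[h --> 0^'+] --> Q a a * 0 + 1.
    apply: cvgD; last exact: cvg_cst.
    apply: cvgM; last exact: cvg_at_right_filter.
    by have := @pQ a a; rewrite eqxx.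
  rewrite mulr0 add0r in H.
  apply: cvg_trans H; apply: near_eq_cvg.
  near=> h.
  have h0 : 0 < h by near: h; exact: nbhs_right_gt.
  by rewrite divfK ?gt_eqF// subrK.
move/cvgrPdist_lt : h1 => /(_ _ e0)[r /= r0 rP].
have main h : 0 <= h -> h < r -> 1 - p h a a < e.
  rewrite le_eqVlt => /predU1P[<- _|h0 hr].
    by case: pP => _ _ -> _; rewrite eqxx subrr.
  apply: le_lt_trans (ler_norm _) _; apply: rP => //=.
  by rewrite sub0r normrN gtr0_norm.
exists r => // u u0 sur; have [su|us] := leP s u.
  rewrite distrC; apply: le_lt_trans (transition_dist pP _ _ s0 su) _.
  by apply: main; rewrite ?subr_ge0// (le_lt_trans _ sur)// distrC ler_norm.
apply: le_lt_trans (transition_dist pP _ _ u0 (ltW us)) _.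
by apply: main; rewrite ?subr_ge0 ?(ltW us)// (le_lt_trans _ sur)// ler_norm.
Unshelve. all: by end_near. Qed.

(** Since the rows of [Q] sum to 0 over [F], both [U e] and [p e] put the mass
    [1 + o(e)] on [F]; for [p], which is stochastic, this bounds the mass that
    leaves [F] in time [e]. *)
Lemma restr_pow_cvg (F : seq S) (U : R -> S -> S -> R) (n : R -> nat) (s : R) :
    uniq F ->
    {in F, forall a, \sum_(c <- F) Q a c = 0} ->
    (forall e, 0 < e < 1 -> {in F &, forall a c, 0 <= U e a c}) ->
    {in F &, forall a c,
      (U e a c - (a == c)%:R) / e @[e --> 0^'+] --> Q a c} ->
    0 <= s -> (n e)%:R * e @[e --> 0^'+] --> s ->
  {in F &, forall a b,
    restr_pow F (U e) (n e) a b @[e --> 0^'+] --> p s a b}.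
Proof.
move=> uF Q0 U0 UQ s0 ns a b aF bF.
have sum1 x : x \in F -> \sum_(c <- F) (x == c)%:R = 1 :> R.
  move=> xF; rewrite (bigD1_seq x)//= eqxx big1 ?addr0// => c cx.
  by rewrite eq_sym (negbTE cx).
(* [K e] is the error of one step in [restr_pow_dist]; it is o(e). *)
pose k e x := `|\sum_(c <- F) U e x c - 1|
  + (\sum_(c <- F) `|p e x c - U e x c| + (1 - \sum_(c <- F) p e x c)).
have k0 e x : 0 < e -> 0 <= k e x.
  move=> e0; rewrite /k addr_ge0// addr_ge0 ?sumr_ge0// subr_ge0.
  by rewrite transition_sum_le1// ltW.
pose K e := \sum_(x <- F) k e x.
have kK e x : 0 < e -> x \in F -> k e x <= K e.
  move=> e0 xF; rewrite /K (bigD1_seq x)//= lerDl sumr_ge0// => y _.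
  exact: k0.
have kcvg x : x \in F -> k e x / e @[e --> 0^'+] --> (0 : R).
  move=> xF.
  pose u e c := (U e x c - (x == c)%:R) / e.
  pose v e c := (p e x c - (x == c)%:R) / e.
  have H : `|\sum_(c <- F) u e c| + (\sum_(c <- F) `|v e c - u e c|
            - \sum_(c <- F) v e c) @[e --> 0^'+] -->
       `|\sum_(c <- F) Q x c| + (\sum_(c <- F) `|Q x c - Q x c|
            - \sum_(c <- F) Q x c).
    apply: cvgD.
      by apply: cvg_norm; apply: cvg_sum_seq => c cF; exact: UQ.
    apply: cvgB; last by apply: cvg_sum_seq => c cF; exact: pQ.
    apply: cvg_sum_seq => c cF; apply: cvg_norm; apply: cvgB; first exact: pQ.
    exact: UQ.
  rewrite Q0// normr0 subr0 add0r big1 in H; last first.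
    by move=> c _; rewrite subrr normr0.
  apply: cvg_trans H; apply: near_eq_cvg.
  near=> e.
  have e0 : 0 < e by near: e; exact: nbhs_right_gt.
  rewrite /k !mulrDl -!mulr_suml !sumrB sum1//.
  rewrite normrM [X in _ * X]ger0_norm ?invr_ge0 ?(ltW e0)//.
  congr (_ + _); congr (_ + _); last by rewrite -mulNr opprB mulrDl.
  rewrite mulr_suml; apply: eq_bigr => c _.
  rewrite -mulrBl normrM [X in _ * X]ger0_norm ?invr_ge0 ?(ltW e0)//.
  by rewrite opprD opprK addrACA addNr addr0.
have Kcvg : K e / e @[e --> 0^'+] --> (0 : R).
  rewrite /K; under eq_fun do rewrite mulr_suml.
  by have := cvg_sum_seq _ kcvg; rewrite big1//; apply.
have Ecvg : expR ((n e)%:R * e * (K e / e)) @[e --> 0^'+] --> (1 : R).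
  have nK : (n e)%:R * e * (K e / e) @[e --> 0^'+] --> (0 : R).
    by have := cvgM (FF := _) ns Kcvg; rewrite mulr0; apply.
  apply: cvg_comp nK _.
  by have := @continuous_expR R 0; rewrite /continuous_at expR0.
apply/cvgrPdist_lt => d d0; have d20 : 0 < d / 2 by rewrite divr_gt0.
have [r r0 rP] := @transition_unif_cont s a b s0 _ d20.
near=> e.
have /andP[e0 e1] : 0 < e < 1 by near: e; exact: near0_itv.
have ner : `|s - (n e)%:R * e| < r by near: e; move/cvgrPdist_lt : ns; apply.
have E1 : `|1 - expR ((n e)%:R * e * (K e / e))| < d / 2.
  by near: e; move/cvgrPdist_lt : Ecvg; apply.
have ne0 : 0 <= (n e)%:R * e by rewrite mulr_ge0// ltW.
rewrite -(subrKA (p ((n e)%:R * e) a b)) (splitr d).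
apply: le_lt_trans (ler_normD _ _) _; apply: ltrD; first exact: rP.
have Ke0 : 0 <= K e by rewrite sumr_ge0// => x _; exact: k0.
have le1 x : x \in F -> \sum_(c <- F) U e x c <= 1 + K e.
  move=> xF; rewrite -lerBlDl; apply: le_trans (ler_norm _) _.
  apply: le_trans (kK _ _ e0 xF); rewrite /k lerDl addr_ge0 ?sumr_ge0//.
  by rewrite subr_ge0 transition_sum_le1// ltW.
have le2 x : x \in F ->
    \sum_(c <- F) `|p e x c - U e x c| + (1 - \sum_(c <- F) p e x c) <= K e.
  by move=> xF; apply: le_trans (kK _ _ e0 xF); rewrite /k lerDr.
apply: le_lt_trans (restr_pow_dist pP uF (ltW e0) _ le1 le2 _ aF bF) _.
  by apply: U0; rewrite e0.
apply: le_lt_trans E1; rewrite distrC; apply: le_trans (ler_norm _).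
rewrite lerD2r -mulrA [e * _]mulrC divfK ?gt_eqF// expRM_natl.
by rewrite lerXn2r ?nnegrE ?addr_ge0 ?expR_ge0// expR_ge1Dx.
Unshelve. all: by end_near. Qed.

End Approximation.

(** * Random variables with countably many values *)

(** A trajectory is fixed at finitely many times: encoding it as a finite
    function makes the set of its values countable. *)
Lemma ffun_eventE (V S : Type) (Z : nat -> V -> S) N (f : {ffun 'I_N.+1 -> S}) :
  [set w | [ffun k : 'I_N.+1 => Z k w] = f] =
  [set w | forall k, (k <= N)%N -> Z k w = f (inord k)].
Proof.
apply/seteqP; split => [w /= <- k kN|w /= wf]; first by rewrite ffunE inordK.
by apply/ffunP => k; rewrite ffunE wf ?inord_val// -ltnS.
Qed.

Section DiscreteDecomposition.
Context {R : realType} {I : countType} {d : measure_display}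
  {T : measurableType d} (P : probability T R) (Z : T -> I).
Hypothesis mZ : forall i, measurable [set w | Z w = i].

Let piece n := [set w | pickle (Z w) = n].

Lemma discrete_pieceE w0 :
  [set w | pickle (Z w) = pickle (Z w0)] = [set w | Z w = Z w0].
Proof.
by apply/seteqP; split => [w /(pcan_inj (@pickleK _))//|w /= ->].
Qed.

Let discrete_bigcup (D : set T) : D = \bigcup_n (D `&` piece n).
Proof.
by apply/seteqP; split => [w Dw|w [n _ []]//]; exists (pickle (Z w)).
Qed.

Lemma discrete_measurable (B : set I) : measurable [set w | B (Z w)].
Proof.
rewrite (discrete_bigcup [set w | B (Z w)]).
apply: bigcupT_measurable => n.
have [->//|/set0P[w0 [/= Bw0 <-]]] :=
  eqVneq ([set w | B (Z w)] `&` piece n) set0.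
rewrite /piece discrete_pieceE (_ : _ `&` _ = [set w | Z w = Z w0])//.
by apply/seteqP; split => [w []//|w /= ww0]; split => //=; rewrite ww0.
Qed.

Lemma discrete_series (D : set T) : measurable D ->
  P D = (\sum_(0 <= n <oo) P (D `&` [set w | pickle (Z w) = n]))%E.
Proof.
move=> mD; have mp n : measurable (D `&` piece n).
  apply: measurableI => //.
  exact: (discrete_measurable [set i | pickle i = n]).
rewrite {1}(discrete_bigcup D); apply: measure_semi_bigcup => //.
- by move=> i j _ _ [w [[_ <-] [_ <-]]].
- exact: bigcupT_measurable.
Qed.

Lemma discrete_sum (D : set T) (F : seq I) : uniq F -> measurable D ->
  P (D `&` [set w | Z w \in F]) = (\sum_(i <- F) P (D `&` [set w | Z w = i]))%E.
Proof.
move=> uF mD; rewrite (fsbig_seq _ _ uF) -measure_fin_bigcup//.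
- rewrite -setI_bigcupr; congr (P (D `&` _)).
  by apply/seteqP; split => [w /= wF|w [i /= iF ->]//]; exists (Z w).
- by move=> i j _ _ [w [/= [_ <-] [_ <-]]].
- by move=> i _; exact: measurableI.
Qed.

Lemma discrete_null (D : set T) (B : set I) : measurable D ->
    (forall i, B i -> P (D `&` [set w | Z w = i]) = 0%E) ->
  P (D `&` [set w | B (Z w)]) = 0%E.
Proof.
move=> mD DB0; set E := D `&` _.
have mE : measurable E by apply: measurableI => //; exact: discrete_measurable.
rewrite (discrete_series mE); apply: eseries0 => n _ _.
have [->//|/set0P[w0 [[Dw0 /= Bw0] <-]]] := eqVneq (E `&` piece n) set0.
rewrite discrete_pieceE; have mi := measurableI _ _ mD (mZ (Z w0)).
apply: (subset_measure0 _ mi _ (DB0 _ Bw0)); last by move=> w [[]].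
exact: measurableI.
Qed.

Lemma discrete_total (D : set T) (F : seq I) : uniq F -> measurable D ->
    (forall i, i \notin F -> P (D `&` [set w | Z w = i]) = 0%E) ->
  P D = (\sum_(i <- F) P (D `&` [set w | Z w = i]))%E.
Proof.
move=> uF mD D0; rewrite -discrete_sum//.
have -> : P D = P ((D `&` [set w | Z w \in F]) `|`
                   (D `&` [set w | [set i | i \notin F] (Z w)])).
  rewrite -setIUr (_ : _ `|` _ = setT) ?setIT//.
  by apply/seteqP; split => // w _ /=; case: (_ \in _); [left|right].
rewrite measureU0//.
- apply: measurableI => //.
  exact: (discrete_measurable [set i | i \in F]).
- by apply: measurableI => //; exact: discrete_measurable.
- exact: discrete_null.
Qed.

End DiscreteDecomposition.

(** * Markov chains *)

Section History.
Context {S : countType} {d : measure_display} {T : measurableType d}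
  (X : nat -> T -> S).
Hypothesis mX : forall n a, measurable [set w | X n w = a].

(** The events decided by [X 0], ..., [X N].  Asking that they do not separate
    points with the same trajectory up to time [N], rather than that they
    belong to a generated sigma-algebra, makes their closure properties
    immediate; as the state space is countable, they are measurable. *)
Definition history (N : nat) (D : set T) :=
  forall w w', (forall k, (k <= N)%N -> X k w = X k w') -> D w -> D w'.

Lemma history_state N k (a : S) : (k <= N)%N -> history N [set w | X k w = a].
Proof. by move=> kN w w' ww' /= <-; rewrite ww'. Qed.

Lemma historyI N D E : history N D -> history N E -> history N (D `&` E).
Proof. by move=> hD hE w w' ww' [Dw Ew]; split; [exact: hD Dw|exact: hE Ew]. Qed.

Lemma historyW N M D : (N <= M)%N -> history N D -> history M D.
Proof.
by move=> NM hD w w' ww'; apply: hD => k kN; apply: ww'; exact: leq_trans NM.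
Qed.

Definition trajectory N (w : T) : {ffun 'I_N.+1 -> S} :=
  [ffun k : 'I_N.+1 => X k w].

Lemma trajectoryE N w0 :
  [set w | trajectory N w = trajectory N w0] =
  [set w | forall k, (k <= N)%N -> X k w = X k w0].
Proof.
rewrite ffun_eventE; apply/seteqP.
by split => w /= ww0 k kN; have := ww0 k kN; rewrite ffunE inordK.
Qed.

Lemma measurable_path N (a : nat -> S) :
  measurable [set w | forall k, (k <= N)%N -> X k w = a k].
Proof.
elim: N => [|N IH].
  rewrite (_ : [set w | _] = [set w | X 0%N w = a 0%N])//.
  by apply/seteqP; split => [w /(_ 0%N)|w /= w0 [|//]] //; apply.
rewrite (_ : [set w | _] =
  [set w | forall k, (k <= N)%N -> X k w = a k] `&` [set w | X N.+1 w = a N.+1]).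
  exact: measurableI.
apply/seteqP; split => [w /= wa|w /= [wa wN] k].
  by split; [move=> k kN; apply: wa; exact: leqW|exact: wa].
by rewrite leq_eqVlt => /predU1P[->//|]; rewrite ltnS; exact: wa.
Qed.

Lemma measurable_trajectory N f : measurable [set w | trajectory N w = f].
Proof. by rewrite ffun_eventE; exact: measurable_path. Qed.

Lemma measurable_history N D : history N D -> measurable D.
Proof.
move=> hD; rewrite (_ : D = [set w | (trajectory N @` D) (trajectory N w)]).
  by apply: discrete_measurable; exact: measurable_trajectory.
apply/seteqP; split => [w Dw|w [w0 Dw0]]; first by exists w.
move=> /esym ww0; apply: hD Dw0 => k kN; apply/esym; move: k kN.
have : [set w | trajectory N w = trajectory N w0] w by [].
by rewrite trajectoryE.
Qed.

End History.

Section MarkovChain.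
Context {R : realType} {S : countType} {d : measure_display}
  {T : measurableType d} (P : probability T R) (X : nat -> T -> S)
  (U : S -> S -> R).
Hypothesis XU : is_markov_chain U P X.
Let mX : forall n a, measurable [set w | X n w = a] := XU.1.

(** The defining identity of a Markov chain is about a single trajectory; an
    event of the history is a countable disjoint union of trajectories. *)
Lemma markov_history N D a b : history X N D ->
  P (D `&` [set w | X N w = a] `&` [set w | X N.+1 w = b]) =
  (P (D `&` [set w | X N w = a]) * (U a b)%:E)%E.
Proof.
move=> hD; set Da := D `&` _.
have hDa : history X N Da by apply: historyI => //; exact: history_state.
have mDa := measurable_history mX hDa.
have mtr f : measurable [set w | trajectory X N w = f].
  exact: measurable_trajectory.
rewrite (discrete_series P mtr (measurableI _ _ mDa _))//.
rewrite [P Da](discrete_series P mtr mDa).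
rewrite muleC -nneseriesZl//; apply: eq_eseriesr => n _; rewrite muleC setIAC.
have [->|/set0P[w0 [Daw0 /= <-]]] :=
  eqVneq (Da `&` [set w | pickle (trajectory X N w) = n]) set0.
  by rewrite set0I measure0 mul0e.
rewrite discrete_pieceE trajectoryE (_ : Da `&` _ =
    [set w | forall k, (k <= N)%N -> X k w = X k w0]); last first.
  apply/seteqP; split => [w []//|w ww0]; split => //.
  by apply: hDa Daw0 => k kN; rewrite ww0.
pose p k := if (k <= N)%N then X k w0 else b.
have -> : [set w | forall k, (k <= N)%N -> X k w = X k w0] =
    [set w | forall k, (k <= N)%N -> X k w = p k].
  by apply/seteqP; split => w /= wk k kN; have := wk k kN; rewrite /p kN.
have pN : p N = a by rewrite /p leqnn; case: Daw0.
have pS : p N.+1 = b by rewrite /p ltnn.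
have := XU.2 N p; rewrite pN pS => <-; congr (P _).
apply/seteqP; split => [w /= [wk wb] k|w /= wk].
  rewrite leq_eqVlt => /predU1P[->|]; first by rewrite pS.
  by rewrite ltnS; exact: wk.
split; first by move=> k kN; apply: wk; exact: leqW.
by rewrite -pS; exact: wk.
Qed.

Lemma markov_steps (F : seq S) : uniq F ->
    (forall a b, a \in F -> b \notin F -> U a b = 0) ->
  forall r N D a b, history X N D -> a \in F -> b \in F ->
  P (D `&` [set w | X N w = a] `&` [set w | X (N + r)%N w = b]) =
  (P (D `&` [set w | X N w = a]) * (restr_pow F U r a b)%:E)%E.
Proof.
move=> uF UF; elim=> [|r IH] N D a b hD aF bF.
  rewrite addn0 /=; have [<-|ab] := eqVneq a b.
    by rewrite -setIA setIid mule1.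
  rewrite mule0 (_ : _ `&` _ = set0) ?measure0//.
  by apply/seteqP; split => // w [[_ /= ->] /= /eqP]; rewrite (negbTE ab).
set Da := D `&` _.
have hDa : history X N Da by apply: historyI => //; exact: history_state.
have mDa := measurable_history mX hDa.
have mDb : measurable (Da `&` [set w | X (N + r.+1)%N w = b]).
  exact: measurableI.
(* On [Da], the chain is almost surely still in [F] at time [N.+1]. *)
rewrite (@discrete_total _ _ _ _ _ (X N.+1) (mX _) _ F)//; last first.
  move=> c cF; rewrite setIAC.
  have E := markov_history a c hD; rewrite UF// mule0 in E.
  apply: (subset_measure0 _ _ _ E); try by apply: measurableI => //;
    exact: measurableI.
  by move=> w [].
rewrite /= -sumEFin fin_num_sume_distrr ?fin_num_measure//.
rewrite big_seq [RHS]big_seq; apply: eq_bigr => c cF.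
rewrite EFinM muleA -markov_history// setIAC addnS -addSn.
by rewrite IH//; exact: historyW hDa.
Qed.

End MarkovChain.

(** * Convergence of probability mass functions *)

Lemma discrete_tight (R : realType) (I : countType) (d : measure_display)
    (T : measurableType d) (P : probability T R) (Z : T -> I)
    (mZ : forall i, measurable [set w | Z w = i]) (B : set I) (e : R) :
  0 < e -> exists G : seq I, [/\ uniq G, {in G, forall i, B i} &
    fine (P [set w | B (Z w)]) - e < fine (P [set w | Z w \in G])].
Proof.
move=> e0; pose G n := undup
  [seq i <- pmap (@pickle_inv I) (iota 0 n) | i \in B].
have GP n i : (i \in G n) = (i \in B) && (pickle i < n)%N.
  rewrite mem_undup mem_filter; congr (_ && _).
  apply/idP/idP; last first.
    move=> ilt; rewrite mem_pmap; apply/mapP.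
    by exists (pickle i); rewrite ?mem_iota ?pickleK_inv.
  rewrite mem_pmap => /mapP[j]; rewrite mem_iota add0n /= => jn ij.
  by have := @pickle_invK I j; rewrite -ij /= => ->.
have mG n : measurable [set w | Z w \in G n].
  exact: (discrete_measurable mZ [set i | i \in G n]).
have : P [set w | Z w \in G n] @[n --> \oo] --> P [set w | B (Z w)].
  rewrite (_ : [set w | B (Z w)] = \bigcup_n [set w | Z w \in G n]).
    apply: nondecreasing_cvg_mu => //; first exact: bigcupT_measurable.
    apply/nondecreasing_seqP => n; apply/subsetPset => w /=.
    by rewrite !GP => /andP[-> /=]; exact: leqW.
  apply/seteqP; split => [w /= Bw|w [n _ /=]]; last first.
    by rewrite GP => /andP[/set_mem].
  by exists (pickle (Z w)).+1 => //=; rewrite GP leqnn mem_set.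
rewrite -[P [set w | B (Z w)]]fineK ?fin_num_measure//; last first.
  exact: discrete_measurable.
move=> /fine_cvg /cvgrPdist_lt /(_ _ e0)[n _ /(_ n (leqnn _)) /=].
move=> /(le_lt_trans (ler_norm _)) H; exists (G n); split.
- exact: undup_uniq.
- by move=> i; rewrite GP => /andP[/set_mem].
- by rewrite ltrBlDr -ltrBlDl.
Qed.

Section DiscreteConvergence.
Context {R : realType} {I : countType}.
Variables (d : R -> measure_display) (T : forall e, measurableType (d e))
  (P : forall e : R, probability (T e) R) (Z : forall e, T e -> I).
Arguments Z : clear implicits.
Variables (d' : measure_display) (T' : measurableType d')
  (P' : probability T' R) (Z' : T' -> I).
Hypothesis mZ : forall e, 0 < e < 1 -> forall i, measurable [set w | Z e w = i].
Hypothesis mZ' : forall i, measurable [set w | Z' w = i].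
Hypothesis PZ : forall i,
  P e [set w | Z e w = i] @[e --> 0^'+] --> P' [set w | Z' w = i].

(** A finite part of [B] carries almost all the mass of the limit in [B], and
    finite sums of masses converge. *)
Lemma pmf_cvg_lower (B : set I) (r : R) : 0 < r -> \forall e \near 0^'+,
  fine (P' [set w | B (Z' w)]) - r < fine (P e [set w | B (Z e w)]).
Proof.
move=> r0; have r20 : 0 < r / 2 by rewrite divr_gt0.
have [G [uG GB GP]] := discrete_tight P' mZ' B r20.
have sumE d0 (T0 : measurableType d0) (P0 : probability T0 R) (Z0 : T0 -> I) :
    (forall i, measurable [set w | Z0 w = i]) ->
    fine (P0 [set w | Z0 w \in G]) =
    \sum_(i <- G) fine (P0 [set w | Z0 w = i]).
  move=> m0; have := discrete_sum P0 m0 uG measurableT; rewrite !setTI => ->.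
  rewrite -sum_fine; last first.
    by move=> i _; rewrite setTI fin_num_measure.
  by apply: eq_bigr => i _; rewrite setTI.
have H : \sum_(i <- G) fine (P e [set w | Z e w = i]) @[e --> 0^'+] -->
    \sum_(i <- G) fine (P' [set w | Z' w = i]).
  apply: cvg_sum_seq => i _; apply: fine_cvg.
  by rewrite fineK ?fin_num_measure.
near=> e.
have e01 : 0 < e < 1 by near: e; exact: near0_itv.
have H1 : `|\sum_(i <- G) fine (P' [set w | Z' w = i])
    - \sum_(i <- G) fine (P e [set w | Z e w = i])| < r / 2.
  by near: e; move/cvgrPdist_lt : H; apply.
have mB : measurable [set w | B (Z e w)].
  by apply: discrete_measurable; exact: mZ.
have mG : measurable [set w | Z e w \in G].
  by apply: (discrete_measurable (mZ e01) [set i | i \in G]).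
have : fine (P e [set w | Z e w \in G]) <= fine (P e [set w | B (Z e w)]).
  rewrite fine_le ?fin_num_measure// le_measure ?inE//.
  by move=> w /= /GB.
move: GP H1; rewrite !sumE//; last exact: mZ.
by move=> GP /(le_lt_trans (ler_norm _)); lra.
Unshelve. all: by end_near. Qed.

(** No mass is lost in the limit, so the lower bound for the complement of [B]
    is an upper bound for [B]. *)
Lemma pmf_cvg (B : set I) :
  P e [set w | B (Z e w)] @[e --> 0^'+] --> P' [set w | B (Z' w)].
Proof.
have mB' B0 : measurable [set w | B0 (Z' w)] by exact: discrete_measurable.
have fin : \forall e \near 0^'+, P e [set w | B (Z e w)] \is a fin_num.
  near=> e; rewrite fin_num_measure//; apply: discrete_measurable; apply: mZ.
  by near: e; exact: near0_itv.
rewrite -[P' _]fineK ?fin_num_measure//; apply/fine_cvgP; split => //.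
apply/cvgrPdist_lt => r r0; near=> e.
have e01 : 0 < e < 1 by near: e; exact: near0_itv.
have mB B0 : measurable [set w | B0 (Z e w)].
  by apply: discrete_measurable; exact: mZ.
have L : fine (P' [set w | B (Z' w)]) - r < fine (P e [set w | B (Z e w)]).
  by near: e; exact: pmf_cvg_lower.
have : fine (P' [set w | (~` B) (Z' w)]) - r
     < fine (P e [set w | (~` B) (Z e w)]).
  by near: e; exact: pmf_cvg_lower.
rewrite (_ : [set w | (~` B) (Z' w)] = ~` [set w | B (Z' w)])//.
rewrite (_ : [set w | (~` B) (Z e w)] = ~` [set w | B (Z e w)])//.
rewrite !probability_setC// !fineB ?fin_num_measure//= => U.
by rewrite ltr_norml; apply/andP; split; lra.
Unshelve. all: by end_near. Qed.

End DiscreteConvergence.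

(** * Poisson-type limits of Markov chains *)

Lemma markov_fdd (R : realType) (S : countType) (d : measure_display)
    (T : measurableType d) (P : probability T R) (X : nat -> T -> S)
    (U : S -> S -> R) (F : seq S) (n : nat -> nat) (a : nat -> S) (J : nat) :
  is_markov_chain U P X -> uniq F ->
  (forall x y, x \in F -> y \notin F -> U x y = 0) ->
  {homo n : i j / (i <= j)%N} -> a J \in F -> a J.+1 \in F ->
  P [set w | forall j, (j <= J.+1)%N -> X (n j) w = a j] =
  (P [set w | forall j, (j <= J)%N -> X (n j) w = a j]
   * (restr_pow F U (n J.+1 - n J) (a J) (a J.+1))%:E)%E.
Proof.
move=> XU uF UF nn aF aF'.
set D := [set w | forall j, (j <= J)%N -> _].
have hD : history X (n J) D.
  by move=> w w' ww' Dw j jJ; rewrite -ww' ?Dw ?nn.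
have := markov_steps XU uF UF (n J.+1 - n J) hD aF aF'.
rewrite subnKC ?nn// (_ : D `&` [set w | X (n J) w = a J] = D); last first.
  by apply/seteqP; split => [w []//|w Dw]; split => //=; exact: Dw.
move=> <-; congr (P _); apply/seteqP; split => [w /= wa|w [Dw wJ] j].
  by split; [move=> j jJ; apply: wa; exact: leqW|exact: wa].
by rewrite leq_eqVlt => /predU1P[->//|]; exact: Dw.
Qed.

Lemma truncn_scaled_cvg (R : realType) (s u : R) : 0 <= s -> s <= u ->
  (Num.truncn (e^-1 * u) - Num.truncn (e^-1 * s))%:R * e @[e --> 0^'+]
  --> u - s.
Proof.
move=> s0 su; have u0 := le_trans s0 su.
apply/cvgrPdist_lt => r r0; near=> e.
have e0 : 0 < e by near: e; exact: nbhs_right_gt.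
have er : e < r by near: e; exact: nbhs_right_lt.
have ve0 : 0 <= e^-1 by rewrite invr_ge0 ltW.
rewrite natrB; last by rewrite le_truncn// ler_wpM2l.
have bnd v : 0 <= v -> (Num.truncn (e^-1 * v))%:R * e <= v
                       < (Num.truncn (e^-1 * v))%:R * e + e.
  move=> v0; have /andP[] := truncn_itv (mulr_ge0 ve0 v0).
  by rewrite mulrC -natr1 ler_pdivlMr// ltr_pdivrMr// mulrDl mul1r => -> ->.
have /andP[s1 s2] := bnd _ s0; have /andP[u1 u2] := bnd _ u0.
rewrite mulrBl ltr_norml; apply/andP; split; lra.
Unshelve. all: by end_near. Qed.

(** The abstract form of the limit: chains with transition matrices
    [I + e Q + o(e)], observed at times of order [1 / e], for which every finite
    set of states is contained in a finite set that the chains do not leave. *)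
Section PoissonLimit.
Context {R : realType} {S : countType} (U : R -> S -> S -> R) (Q : S -> S -> R).
Hypothesis finite_closed : forall a : seq S, exists F : seq S,
  [/\ uniq F, {subset a <= F},
      forall e x y, 0 < e < 1 -> x \in F -> y \notin F -> U e x y = 0 &
      {in F, forall x, \sum_(y <- F) Q x y = 0}].
Hypothesis U_ge0 : forall e x y, 0 < e < 1 -> 0 <= U e x y.
Hypothesis UQ : forall x y,
  (U e x y - (x == y)%:R) / e @[e --> 0^'+] --> Q x y.
Variables (d : R -> measure_display) (T : forall e, measurableType (d e))
  (P : forall e : R, probability (T e) R) (X : forall e, nat -> T e -> S).
Arguments X : clear implicits.
Variables (d' : measure_display) (T' : measurableType d')
  (P' : probability T' R) (Y : R -> T' -> S).
Hypothesis XU : forall e, 0 < e < 1 -> is_markov_chain (U e) (P e) (X e).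
Hypothesis YQ : is_markov_jump_process Q P' Y.
Hypothesis XY0 : forall e, 0 < e < 1 -> forall x,
  P e [set w | X e 0%N w = x] = P' [set w | Y 0 w = x].

Let n e s := Num.truncn (e^-1 * s : R).

Lemma fdd_cvg (s : nat -> R) (a : nat -> S) (J : nat) :
  s 0%N = 0 -> nondecreasing_seq s ->
  P e [set w | forall j, (j <= J)%N -> X e (n e (s j)) w = a j] @[e --> 0^'+]
  --> P' [set w | forall j, (j <= J)%N -> Y (s j) w = a j].
Proof.
move=> s0 ns; have sp j : 0 <= s j by rewrite -s0 ns.
have [mY [p [pP pQ Yp]]] := YQ.
elim: J => [|J IH].
  have E0 (V : Type) (Z : nat -> V -> S) :
      [set w | forall j, (j <= 0)%N -> Z j w = a j] = [set w | Z 0%N w = a 0%N].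
    by apply/seteqP; split => [w /(_ 0%N)|w /= w0 [|//]] //; apply.
  rewrite (E0 _ (fun j => Y (s j))) s0.
  apply: cvg_near_cst; near=> e.
  rewrite (E0 _ (fun j => X e (n e (s j)))) s0 /n mulr0 truncn0.
  by apply: XY0; near: e; exact: near0_itv.
have [F [uF aF UF QF]] := finite_closed [:: a J; a J.+1].
have aJ : a J \in F by apply: aF; rewrite inE eqxx.
have aJ' : a J.+1 \in F by apply: aF; rewrite !inE eqxx orbT.
rewrite Yp//.
have H : (P e [set w | forall j, (j <= J)%N -> X e (n e (s j)) w = a j] *
   (restr_pow F (U e) (n e (s J.+1) - n e (s J)) (a J) (a J.+1))%:E)%E
   @[e --> 0^'+] -->
   (P' [set w | forall j, (j <= J)%N -> Y (s j) w = a j] *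
    (p (s J.+1 - s J) (a J) (a J.+1))%:E)%E.
  apply: cvgeM => //.
    have mD : measurable [set w | forall j, (j <= J)%N -> Y (s j) w = a j].
      by apply: (@measurable_path _ _ _ (fun j => Y (s j))) => i x; exact: mY.
    by rewrite -(fineK (fin_num_measure P' _ mD)) mule_def_fin.
  apply: cvg_EFin; first by near=> e.
  apply: (restr_pow_cvg pP pQ uF QF) => //.
  - by move=> e e01 x y _ _; exact: U_ge0.
  - by rewrite subr_ge0; exact: ns.
  - by apply: truncn_scaled_cvg => //; exact: ns.
apply: cvg_trans H; apply: near_eq_cvg; near=> e.
have /andP[e0 e1] : 0 < e < 1 by near: e; exact: near0_itv.
rewrite -(@markov_fdd _ _ _ _ _ _ _ _ (fun j => n e (s j)))//.
- by apply: XU; rewrite e0.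
- by move=> x y; apply: UF; rewrite e0.
- move=> i j ij; apply: le_truncn; rewrite ler_wpM2l ?invr_ge0 ?(ltW e0)//.
  exact: ns.
Unshelve. all: by end_near. Qed.

Theorem poisson_limit (k : nat) (tau : 'I_k -> R) (A : set ('I_k -> S)) :
  (forall j, 0 <= tau j) ->
  (forall i j : 'I_k, (i <= j)%N -> tau i <= tau j) ->
  P e [set w | A (fun j => X e (n e (tau j)) w)] @[e --> 0^'+]
  --> P' [set w | A (fun j => Y (tau j) w)].
Proof.
move=> tau0 taun.
(* Time 0 is added in front, since the initial law is part of the data, and the
   times are continued beyond [tau] as a nondecreasing sequence. *)
pose s j := \big[Num.max/0]_(i < k | (i < j)%N) tau i.
have s0 : s 0%N = 0 by rewrite /s big_pred0.
have sS (j : 'I_k) : s (lift ord0 j) = tau j.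
  apply/eqP; rewrite eq_le; apply/andP; split; last first.
    by rewrite /s le_bigmax_cond.
  by apply: bigmax_le => // i; rewrite lift0 ltnS; exact: taun.
have ns : nondecreasing_seq s.
  apply/nondecreasing_seqP => j; apply: bigmax_le.
    exact: bigmax_ge_id.
  by move=> i ij; rewrite /s le_bigmax_cond// leqW.
pose ZX e (w : T e) : {ffun 'I_k.+1 -> S} :=
  [ffun j : 'I_k.+1 => X e (n e (s j)) w].
pose ZY w : {ffun 'I_k.+1 -> S} := [ffun j : 'I_k.+1 => Y (s j) w].
pose B := [set f : {ffun 'I_k.+1 -> S} | A (fun j => f (lift ord0 j))].
have [mY _] := YQ.
have mZX e : 0 < e < 1 -> forall f, measurable [set w | ZX e w = f].
  move=> e01 f; rewrite (ffun_eventE (fun j => X e (n e (s j)))).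
  apply: (@measurable_path _ _ _ (fun j => X e (n e (s j)))) => i x.
  exact: (XU e01).1.
have mZY f : measurable [set w | ZY w = f].
  rewrite (ffun_eventE (fun j => Y (s j))).
  apply: (@measurable_path _ _ _ (fun j => Y (s j))) => i x; apply: mY.
  by rewrite -s0; exact: ns.
have PZ f : P e [set w | ZX e w = f] @[e --> 0^'+] --> P' [set w | ZY w = f].
  rewrite (ffun_eventE (fun j => Y (s j))).
  under eq_fun do rewrite (ffun_eventE (fun j => X _ (n _ (s j)))).
  exact: fdd_cvg.
have BE (V : Type) (Z : R -> V -> S) :
    [set w | B [ffun j : 'I_k.+1 => Z (s j) w]] =
    [set w | A (fun j => Z (tau j) w)].
  have E w : (fun j => [ffun j : 'I_k.+1 => Z (s j) w] (lift ord0 j)) =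
      (fun j => Z (tau j) w).
    by apply/funext => j; rewrite ffunE sS.
  by apply/seteqP; split => w; rewrite /B /= E.
rewrite -(BE _ Y); under eq_fun do rewrite -(BE _ (fun r => X _ (n _ r))).
exact: (@pmf_cvg _ _ _ _ _ ZX _ _ _ ZY mZX mZY PZ B).
Qed.

End PoissonLimit.

(** * Right derivatives at 0 *)

Section RightDerivative.
Context {R : realType}.
Implicit Types (f g : R -> R) (c l : R).

(** The value [c] is part of the data: [f 0] need not be [c]. *)
Definition has_rderiv f c l := (f e - c) / e @[e --> 0^'+] --> l.

Lemma has_rderiv_cst c : has_rderiv (fun=> c) c 0.
Proof.
by rewrite /has_rderiv; under eq_fun do rewrite subrr mul0r; exact: cvg_cst.
Qed.

Lemma has_rderiv_cvg f c l : has_rderiv f c l -> f e @[e --> 0^'+] --> c.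
Proof.
move=> fl; have H : (f e - c) / e * e + c @[e --> 0^'+] --> l * 0 + c.
  apply: cvgD; last exact: cvg_cst.
  by apply: cvgM => //; exact: cvg_at_right_filter.
rewrite mulr0 add0r in H; apply: cvg_trans H; apply: near_eq_cvg; near=> e.
have e0 : 0 < e by near: e; exact: nbhs_right_gt.
by rewrite divfK ?gt_eqF// subrK.
Unshelve. all: by end_near. Qed.

Lemma has_rderivM f g c l c' l' : has_rderiv f c l -> has_rderiv g c' l' ->
  has_rderiv (fun e => f e * g e) (c * c') (l * c' + c * l').
Proof.
move=> fl gl; rewrite /has_rderiv.
have -> : (fun e => (f e * g e - c * c') / e) =
    (fun e => (f e - c) / e * g e + c * ((g e - c') / e)).
  by apply/funext => e; ring.
apply: cvgD; first by apply: cvgM => //; exact: has_rderiv_cvg gl.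
by apply: cvgM => //; exact: cvg_cst.
Qed.

Lemma has_rderiv1B f c l :
  has_rderiv f c l -> has_rderiv (fun e => 1 - f e) (1 - c) (- l).
Proof.
move=> fl; rewrite /has_rderiv.
have -> : (fun e => (1 - f e - (1 - c)) / e) = (fun e => - ((f e - c) / e)).
  by apply/funext => e; ring.
exact: cvgN.
Qed.

Lemma has_rderivX f l n :
  has_rderiv f 1 l -> has_rderiv (fun e => f e ^+ n) 1 (n%:R * l).
Proof.
move=> fl; elim: n => [|n IH].
  by rewrite mul0r; under eq_fun do rewrite expr0; exact: has_rderiv_cst.
under eq_fun do rewrite exprS.
have := has_rderivM fl IH; rewrite !mulr1 mul1r.
by rewrite -natr1 mulrDl mul1r addrC.
Qed.

Lemma has_rderiv_prod (I : eqType) (r : seq I) (f : I -> R -> R)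
    (c l : I -> R) : uniq r ->
  (forall i, i \in r -> has_rderiv (f i) (c i) (l i)) ->
  has_rderiv (fun e => \prod_(i <- r) f i e) (\prod_(i <- r) c i)
    (\sum_(i <- r) l i * \prod_(j <- r | j != i) c j).
Proof.
elim: r => [_ _|i r IH /= /andP[ir ur] fl].
  rewrite !big_nil; under eq_fun do rewrite big_nil; exact: has_rderiv_cst.
under eq_fun do rewrite big_cons.
rewrite !big_cons eqxx /=.
have -> : \prod_(j <- r | j != i) c j = \prod_(j <- r) c j.
  rewrite big_seq_cond [RHS]big_seq; apply: eq_bigl => j.
  by case: (boolP (j \in r)) => //= jr; apply: contraNneq ir => <-.
rewrite (_ : \sum_(j <- r) _ =
    c i * \sum_(j <- r) l j * \prod_(k <- r | k != j) c k); last first.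
  rewrite mulr_sumr big_seq [RHS]big_seq; apply: eq_bigr => j jr.
  rewrite big_cons ifT; first by rewrite mulrCA.
  by apply: contraNneq ir => ->.
apply: has_rderivM; first by apply: fl; rewrite inE eqxx.
by apply: IH => // j jr; apply: fl; rewrite inE jr orbT.
Qed.

Lemma has_rderiv_oneB : has_rderiv (fun e => 1 - e) 1 (- 1).
Proof.
rewrite -[X in has_rderiv _ X _]subr0; apply: has_rderiv1B.
rewrite /has_rderiv; apply: cvg_near_cst; near=> e.
have e0 : 0 < e by near: e; exact: nbhs_right_gt.
by rewrite subr0 divff// gt_eqF.
Unshelve. all: by end_near. Qed.

Lemma has_rderiv_oneBV : has_rderiv (fun e => (1 - e)^-1) 1 1.
Proof.
have H : (1 - e)^-1 @[e --> 0^'+] --> (1 : R).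
  rewrite -[X in _ --> X]invr1; apply: cvgV; first exact: oner_neq0.
  exact: has_rderiv_cvg has_rderiv_oneB.
rewrite /has_rderiv; apply: cvg_trans H; apply: near_eq_cvg; near=> e.
have /andP[e0 e1] : 0 < e < 1 by near: e; exact: near0_itv.
have e10 : 1 - e != 0 by rewrite subr_eq0 gt_eqF.
by field; rewrite e10 gt_eqF.
Unshelve. all: by end_near. Qed.

End RightDerivative.

(** * Blocks of moving particles *)

Section Blocks.
Variables (b : nat -> bool) (m : nat).
Hypothesis bm : b m.+1 = false.
Let is_end k := b k && ~~ b k.+1.

Lemma exists_block_end k : (1 <= k <= m)%N -> b k ->
  exists2 i, (k <= i <= m)%N & is_end i.
Proof.
move=> /andP[k1 km] bk.
have [n] := ubnP (m - k); elim: n k k1 km bk => // n IH k k1 km bk mkn.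
have [bk'|bk'] := boolP (b k.+1); last first.
  by exists k; rewrite ?leqnn ?km /is_end ?bk.
have km' : (k < m)%N.
  by rewrite ltn_neqAle km andbT; apply: contraTneq bk' => ->; rewrite bm.
have [||||i /andP[ki im] si] := IH k.+1 => //; first by lia.
by exists i; rewrite ?im ?andbT// ltnW.
Qed.

(** An indicator on 1, ..., m that has one block, with the last index [i],
    vanishes beyond [i], by descending induction from [m.+1], and is
    nondecreasing on 1, ..., [i]; so the block begins at the least index where
    it is 1. *)
Lemma blockP i : (1 <= i <= m)%N ->
  reflect
    (exists2 j, (1 <= j <= i)%N &
       forall k, (1 <= k <= m)%N -> b k = (j <= k <= i)%N)
    (is_end i && all (fun k => (k == i) || ~~ is_end k) (iota 1 m)).
Proof.
move=> /andP[i1 im]; apply: (iffP andP) => [[si /allP ui]|[j /andP[j1 ji] bE]].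
  have {}ui k : (1 <= k <= m)%N -> k != i -> b k -> b k.+1.
    move=> km ki bk; have := ui k; rewrite mem_iota add1n ltnS => /(_ km).
    by rewrite (negbTE ki) /is_end bk /= negbK.
  have /andP[bi bi'] := si.
  have above k : (i < k <= m)%N -> b k = false.
    move=> /andP[ik km]; apply/negP => bk.
    have [n] := ubnP (m - k); elim: n k ik km bk => // n IH k ik km bk mkn.
    have bk' : b k.+1.
      by apply: ui bk; rewrite ?km ?andbT ?(leq_ltn_trans _ ik)// gtn_eqF.
    have km' : (k < m)%N.
      by rewrite ltn_neqAle km andbT; apply: contraTneq bk' => ->; rewrite bm.
    by apply: (IH k.+1) => //; [exact: ltnW|lia].
  have mono k l : (1 <= k)%N -> (k <= l <= i)%N -> b k -> b l.
    move=> k1 /andP[kl li] bk; elim: l kl li => [|l IH]; first by lia.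
    rewrite leq_eqVlt => /predU1P[<-//|kl] li.
    by apply: ui; [lia|lia|apply: IH; lia].
  have ex : exists k, (1 <= k)%N && b k by exists i; rewrite i1 bi.
  case: (ex_minnP ex) => j /andP[j1 bj] jmin.
  have ji : (j <= i)%N by apply: jmin; rewrite i1 bi.
  exists j; first by rewrite j1.
  move=> k /andP[k1 km]; have [ik|ki] := ltnP i k.
    by rewrite andbF above// ik.
  rewrite andbT; apply/idP/idP => [bk|jk]; first by apply: jmin; rewrite k1.
  by apply: (mono j); rewrite ?jk.
have bE' k : (1 <= k <= m.+1)%N -> b k = (j <= k <= i)%N.
  move=> /andP[k1]; rewrite leq_eqVlt => /predU1P[->|km].
    by rewrite bm; apply/esym/negbTE; lia.
  by apply: bE; rewrite k1.
split; first by rewrite /is_end !bE' ?i1//; lia.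
apply/allP => k; rewrite mem_iota add1n ltnS => /andP[k1 km].
have [//|ki] := eqVneq k i; rewrite /is_end !bE'; lia.
Qed.

(** The first index [j] of the block that ends at [i] is unique. *)
Lemma count_blocks i : (1 <= i <= m)%N ->
  (\sum_(1 <= j < i.+1) all (fun k => b k == (j <= k <= i)%N) (iota 1 m))%N =
  (is_end i && all (fun k => (k == i) || ~~ is_end k) (iota 1 m)) :> nat.
Proof.
move=> im; case: (blockP im) => [[j ji bE]|nex]; last first.
  rewrite big_nat big1// => j ji; apply/eqP; rewrite eqb0.
  apply/negP => /allP H.
  case: nex; exists j => // k km; apply/eqP/H.
  by rewrite mem_iota add1n ltnS.
have jin : j \in index_iota 1 i.+1 by rewrite mem_index_iota ltnS.
rewrite (bigD1_seq j)//= ?iota_uniq//.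
rewrite (_ : all _ _ = true); last first.
  by apply/allP => k; rewrite mem_iota add1n ltnS => km; rewrite bE.
rewrite big_seq_cond big1 ?addn0// => l /andP[].
rewrite mem_index_iota ltnS => li lj; apply/eqP; rewrite eqb0.
apply/negP => /allP H.
have [lk|] := ltnP l j.
  have := H l; rewrite mem_iota add1n ltnS => /(_ _)/eqP.
  by rewrite bE; lia.
have := H j; rewrite mem_iota add1n ltnS => /(_ _)/eqP.
by rewrite bE; lia.
Qed.

End Blocks.

(** * Configurations of particles *)

Section Configurations.
Context {m : nat}.
Implicit Types x y : config m.

Definition position x i : nat := nth 0%N (sval x) i.-1.

Lemma size_config x : size (sval x) = m.
Proof. exact: size_tuple. Qed.

Lemma partE x i : (1 <= i <= m)%N -> part x i = (position x i)%:Z.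
Proof.
by move=> im; rewrite /part (nth_map 0%N)// size_config; lia.
Qed.

Lemma part_max x : part x m.+1 = -1.
Proof. by rewrite /part nth_default//= size_map size_config. Qed.

Lemma position_lt x i : (1 <= i)%N -> (i < m)%N ->
  (position x i.+1 < position x i)%N.
Proof.
move=> i1 im; have /sortedP := svalP x => /(_ 0%N i.-1).
by rewrite size_config /position /= prednK//; apply.
Qed.

Lemma gap_ge0 x i : (1 <= i <= m)%N -> 0 <= part x i - part x i.+1 - 1.
Proof.
move=> /andP[i1 im]; rewrite partE ?i1//.
move: im; rewrite leq_eqVlt => /predU1P[->|im].
  by rewrite part_max; lia.
by rewrite partE ?im//; have := position_lt x i1 im; lia.
Qed.

Lemma config_inj x y :
  (forall i, (1 <= i <= m)%N -> part x i = part y i) -> x = y.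
Proof.
move=> xy; apply: val_inj; apply: val_inj; apply: (@eq_from_nth _ 0%N).
  by rewrite !size_config.
move=> i; rewrite size_config => im.
by have := xy i.+1; rewrite im => /(_ isT); rewrite !partE ?im// => -[].
Qed.

Definition bounded_configs (M : nat) : seq (config m) :=
  undup (pmap (fun t : m.-tuple 'I_M.+1 => insub (map_tuple val t))
    (enum {: m.-tuple 'I_M.+1})).

Lemma mem_bounded_configs M x :
  (x \in bounded_configs M) = all (fun i => position x i <= M)%N (iota 1 m).
Proof.
rewrite mem_undup mem_pmap; apply/mapP/allP => [[t _ xt] i|xM].
  rewrite mem_iota add1n ltnS => im.
  have xE : sval x = map_tuple val t.
    by case: insubP xt => // u _ <- [->].
  rewrite /position xE /= (nth_map ord0) ?size_tuple; last by lia.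
  by rewrite -ltnS.
exists (map_tuple inord (sval x)); first by rewrite mem_enum.
have -> : map_tuple val (map_tuple (@inord M) (sval x)) = sval x.
  apply: val_inj => /=; rewrite -map_comp -[RHS]map_id; apply/eq_in_map => a.
  move=> /(nthP 0%N)[i]; rewrite size_config => im <-.
  by rewrite /= inordK// ltnS; apply: (xM i.+1); rewrite mem_iota; lia.
by rewrite (valK x).
Qed.

Lemma bounded_configs_uniq M : uniq (bounded_configs M).
Proof. exact: undup_uniq. Qed.

Lemma bounded_configs_cover (a : seq (config m)) :
  exists M, {subset a <= bounded_configs M}.
Proof.
exists (\sum_(x <- a) \sum_(i <- iota 1 m) position x i)%N => x xa.
rewrite mem_bounded_configs; apply/allP => i im.
rewrite (big_rem x)//= (big_rem i)//=; lia.
Qed.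

Definition one_step x y : bool :=
  all (fun i => (part y i == part x i) || (part y i == part x i - 1)) (iota 1 m).

Definition moved x y i : bool := part y i == part x i - 1.

Lemma one_step_stay x y i : one_step x y -> (1 <= i <= m.+1)%N ->
  (part y i == part x i) = ~~ moved x y i.
Proof.
move=> /allP xy /andP[i1]; rewrite leq_eqVlt => /predU1P[->|im].
  by rewrite /moved !part_max.
have := xy i; rewrite mem_iota add1n ltnS i1 -ltnS im => /(_ isT).
rewrite /moved; lia.
Qed.

Lemma moved_max x y : moved x y m.+1 = false.
Proof. by rewrite /moved !part_max. Qed.

Lemma one_step_bounded M x y : one_step x y ->
  x \in bounded_configs M -> y \in bounded_configs M.
Proof.
rewrite !mem_bounded_configs => /allP xy /allP xM; apply/allP => i ii.
have := xM i ii; have := xy i ii; move: ii; rewrite mem_iota add1n ltnS => im.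
by rewrite !partE//; lia.
Qed.

Lemma block_jumpE i j x y : one_step x y ->
  block_jump i j x y = all (fun k => moved x y k == (j <= k <= i)%N) (iota 1 m).
Proof.
move=> xy; apply: eq_in_all => k; rewrite mem_iota add1n ltnS => /andP[k1 km].
case: ifP => _; first by rewrite eqb_id.
by rewrite (one_step_stay xy) ?k1 ?leqW// eqbF_neg.
Qed.

Lemma block_jump_one_step i j x y : block_jump i j x y -> one_step x y.
Proof.
move=> /allP H; apply/allP => k /H /eqP ->.
by case: ifP; rewrite eqxx ?orbT.
Qed.

Lemma block_jump_neq i j x : (1 <= j <= i)%N -> (i <= m)%N ->
  block_jump i j x x = false.
Proof.
move=> ji im; apply/negP => /allP/(_ i).
rewrite mem_iota add1n ltnS im andbT => /(_ _)/eqP.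
by case/andP: ji => j1 ji; rewrite ji leqnn /= => /(_ (leq_trans j1 ji)); lia.
Qed.

(** The block [j], ..., [i] may move as soon as there is room behind its last
    particle: the positivity of the gap also makes all its entries positive. *)
Lemma block_jump_exists M x i j : (1 <= j <= i)%N -> (i <= m)%N ->
    0 < part x i - part x i.+1 - 1 -> x \in bounded_configs M ->
  exists2 y, y \in bounded_configs M & block_jump i j x y.
Proof.
move=> /andP[j1 ji] im gi xM.
pose v k := (position x k.+1 - (j <= k.+1 <= i))%N.
have sv : size (mkseq v m) == m by rewrite size_mkseq.
have xi k : (1 <= k <= i)%N -> (position x i <= position x k)%N.
  move=> /andP[k1 ki]; have [n] := ubnP (i - k).
  elim: n k k1 ki => // n IH k k1; rewrite leq_eqVlt => /predU1P[->//|ki] ikn.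
  apply: leq_trans (ltnW (position_lt x k1 (leq_trans ki im))); apply: IH => //; lia.
have xi0 : (0 < position x i)%N.
  move: gi; rewrite partE; last lia.
  have [->|im'] := eqVneq i m; first by rewrite part_max; lia.
  by rewrite partE; lia.
have so : sorted gtn (mkseq v m).
  apply/(sortedP 0%N) => k; rewrite size_mkseq => km.
  rewrite !nth_mkseq//; last exact: ltnW.
  rewrite /= /v; have := @position_lt x k.+1 isT km.
  have [ki|ki] := eqVneq k.+1 i.
    move: gi; rewrite !partE; [|lia|lia].
    by rewrite -ki ltnn; lia.
  by have := xi k.+2; lia.
pose y : config m := exist _ (Tuple sv) so.
have yE k : (1 <= k <= m)%N -> position y k = (position x k - (j <= k <= i))%N.
  by case: k => // k /andP[_ km]; rewrite {1}/position /= nth_mkseq.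
have xy : block_jump i j x y.
  apply/allP => k; rewrite mem_iota add1n ltnS => km.
  by rewrite !partE// yE//; have := xi k; case: ifP; lia.
by exists y => //; apply: one_step_bounded xM; exact: block_jump_one_step xy.
Qed.

Lemma block_jump_unique i j x y z :
  block_jump i j x y -> block_jump i j x z -> y = z.
Proof.
move=> /allP xy /allP xz; apply: config_inj => k km.
have ki : k \in iota 1 m by rewrite mem_iota add1n ltnS.
by rewrite (eqP (xy k ki)) (eqP (xz k ki)).
Qed.

End Configurations.

(** * The generator of the Hall-Littlewood walks *)

Section HallLittlewood.
Context {R : realType} {m : nat}.
Hypothesis m_gt0 : (1 <= m)%N.
Implicit Types (x y : config m) (t e : R).

Definition gap x i : nat := absz (part x i - part x i.+1 - 1)%R.

Lemma gapE x i : (1 <= i <= m)%N -> part x i - part x i.+1 - 1 = (gap x i)%:Z.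
Proof. by move=> /(gap_ge0 x) g0; rewrite /gap gez0_abs. Qed.

(** With [part x m.+1 = -1] and an immobile particle [m.+1], the last particle
    contributes a factor of the same form as the others. *)
Definition hl_factor t x y i : R :=
  if moved x y i then
    t ^+ (m - i) * (if moved x y i.+1 then 1 else 1 - t ^+ gap x i)
  else t ^+ position x i.

Lemma HL_weightE t x y : one_step x y ->
  HL_weight t x y =
  t^-1 ^+ 'C(m, 2) * \prod_(1 <= i < m.+1) hl_factor t x y i.
Proof.
move=> xy; rewrite big_nat_recr//= [\prod_(1 <= i < m) _ * _]mulrC mulrA.
rewrite /HL_weight -exprnN exprVn; congr (_ * _ * _).
  rewrite (one_step_stay xy) ?m_gt0 ?leqnSn// -/(moved x y m).
  rewrite /hl_factor moved_max subnn expr0 mul1r.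
  rewrite (_ : gap x m = position x m); last first.
    by rewrite /gap part_max partE ?m_gt0 ?leqnn//; lia.
  rewrite partE ?m_gt0 ?leqnn// -exprnP.
  by case: moved; rewrite !(mulr1, mulr0, add0r, addr0).
apply: eq_big_nat => i /andP[i1 im].
rewrite !(one_step_stay xy) ?i1 ?leqW ?(ltnW im)//.
rewrite -!/(moved _ _ _) /hl_factor subzn ?(ltnW im)//.
rewrite gapE ?i1 ?(ltnW im)// partE ?i1 ?(ltnW im)// -!exprnP.
by do 2![case: moved]; rewrite !(mulr1, mulr0, add0r, addr0, subr0).
Qed.

Definition block_end x y i : bool := moved x y i && ~~ moved x y i.+1.

(** The derivative of [hl_factor (1 - e) x y i] at [e = 0]. *)
Definition hl_rate x y i : R :=
  if moved x y i then
    if moved x y i.+1 then - (m - i)%:R else (gap x i)%:R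
  else - (position x i)%:R.

Lemma has_rderiv_hl_factor x y i :
  has_rderiv (fun e => hl_factor (1 - e) x y i) (~~ block_end x y i)%:R
    (hl_rate x y i).
Proof.
have D n : has_rderiv (fun e : R => (1 - e) ^+ n) 1 (- n%:R).
  by rewrite -mulrN1; apply: has_rderivX; exact: has_rderiv_oneB.
rewrite /hl_factor /hl_rate /block_end.
case: moved => /=; last exact: D.
case: moved => /=; first by under eq_fun do rewrite mulr1; exact: D.
have := has_rderivM (D (m - i)%N) (has_rderiv1B (D (gap x i))).
by rewrite subrr !mulr0 add0r mul1r opprK.
Qed.

Lemma has_rderiv_HL x y : one_step x y ->
  has_rderiv (fun e => HL_weight (1 - e) x y)
    (\prod_(1 <= i < m.+1) (~~ block_end x y i)%:R)
    ('C(m, 2)%:R * \prod_(1 <= i < m.+1) (~~ block_end x y i)%:R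
     + \sum_(1 <= i < m.+1) hl_rate x y i *
         \prod_(1 <= j < m.+1 | j != i) (~~ block_end x y j)%:R).
Proof.
move=> xy.
have -> : (fun e => HL_weight (1 - e) x y) = (fun e => (1 - e)^-1 ^+ 'C(m, 2) *
    \prod_(1 <= i < m.+1) hl_factor (1 - e) x y i).
  by apply/funext => e; exact: HL_weightE.
have := has_rderivM (has_rderivX (n := 'C(m, 2)) has_rderiv_oneBV)
  (has_rderiv_prod (iota_uniq 1 m)
    (fun i _ => @has_rderiv_hl_factor x y i)).
by rewrite !mul1r mulr1 /index_iota subn1.
Qed.

Lemma clock_rateE x i : (1 <= i <= m)%N ->
  clock_rate x i = i%:R * (gap x i)%:R :> R.
Proof. by move=> im; rewrite /clock_rate gapE// intrM. Qed.

(** Abel summation; [part x m.+1 = -1] kills the boundary term. *)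
Lemma sum_clock_rate x : \sum_(1 <= i < m.+1) clock_rate x i =
  \sum_(1 <= i < m.+1) (position x i)%:R - 'C(m, 2)%:R :> R.
Proof.
pose f i : R := (part x i)%:~R.
have H n : \sum_(1 <= i < n.+1) i%:R * (f i - f i.+1 - 1) =
    \sum_(1 <= i < n.+1) f i - n%:R * (f n.+1 + 1) - 'C(n, 2)%:R.
  elim: n => [|n IH]; first by rewrite !big_geq// mul0r bin0n !subr0.
  rewrite big_nat_recr// IH [in RHS]big_nat_recr//= binS bin1 natrD -natr1.
  by ring.
transitivity (\sum_(1 <= i < m.+1) i%:R * (f i - f i.+1 - 1)).
  by apply: eq_bigr => i _; rewrite /clock_rate /f intrM !intrB.
rewrite H /f part_max addNr mulr0 subr0; congr (_ - _).
by apply: eq_big_nat => i im; rewrite partE.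
Qed.

Lemma cont_rateE x y : cont_rate x y =
  \sum_(1 <= i < m.+1) (gap x i)%:R *
    (\sum_(1 <= j < i.+1) block_jump i j x y)%:R :> R.
Proof.
apply: eq_big_nat => i /andP[i1 im]; rewrite natr_sum mulr_sumr.
apply: eq_bigr => j _; rewrite clock_rateE ?i1//.
by rewrite [i%:R * _]mulrC mulfK// pnatr_eq0 -lt0n.
Qed.

Lemma cont_rate_notstep x y : ~~ one_step x y -> cont_rate x y = 0 :> R.
Proof.
move=> xy; rewrite cont_rateE big1// => i _; rewrite big1 ?mulr0// => j _.
by apply/eqP; rewrite eqb0; apply: contra xy; exact: block_jump_one_step.
Qed.

Lemma one_step_refl x : one_step x x.
Proof. by apply/allP => i _; rewrite eqxx. Qed.

Lemma moved_refl x i : moved x x i = false.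
Proof. by rewrite /moved; lia. Qed.

Lemma cont_rate_refl x : cont_rate x x = 0 :> R.
Proof.
rewrite cont_rateE big_nat big1// => i /andP[i1 im].
rewrite big_nat big1 ?mulr0// => j ji.
by rewrite block_jump_neq.
Qed.

(** If [x != y] there is a block.  In the sum of the product rule, the term [i]
    contains the factors of all blocks but the one that ends at [i], so it
    vanishes unless that one is the only block. *)
Lemma HL_limit x y : one_step x y ->
  \prod_(1 <= i < m.+1) (~~ block_end x y i)%:R = (x == y)%:R :> R /\
  'C(m, 2)%:R * \prod_(1 <= i < m.+1) (~~ block_end x y i)%:R
     + \sum_(1 <= i < m.+1) hl_rate x y i *
         \prod_(1 <= j < m.+1 | j != i) (~~ block_end x y j)%:R
  = cont_generator x y :> R.
Proof.
move=> xy; rewrite /cont_generator; have [<-|nxy] := eqVneq x y.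
  have p1 (Q : pred nat) :
      \prod_(1 <= i < m.+1 | Q i) (~~ block_end x x i)%:R = 1 :> R.
    by rewrite big1// => i _; rewrite /block_end moved_refl.
  split; rewrite p1// mulr1 sum_clock_rate opprB; congr (_ + _).
  by rewrite -sumrN; apply: eq_bigr => i _; rewrite p1 /hl_rate moved_refl mulr1.
have [k km mk] : exists2 k, (1 <= k <= m)%N & moved x y k.
  apply: contrapT => nex; move/eqP : nxy; apply; apply: config_inj => k km.
  apply/esym/eqP; rewrite (one_step_stay xy); last by lia.
  by apply/negP => mk; apply: nex; exists k.
have [i ki si] := exists_block_end (moved_max x y) km mk.
have im : (1 <= i <= m)%N by lia.
have prod0 (Q : pred nat) l : (1 <= l <= m)%N -> Q l -> block_end x y l ->
    \prod_(1 <= j < m.+1 | Q j) (~~ block_end x y j)%:R = 0 :> R.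
  move=> lm Ql sl; rewrite big_mkcond (bigD1_seq l)/= ?iota_uniq//.
    by rewrite Ql sl mul0r.
  by rewrite mem_index_iota ltnS.
split; rewrite (prod0 _ i)// mulr0 add0r cont_rateE.
apply: eq_big_nat => l lm.
under [in RHS]eq_bigr do rewrite block_jumpE//.
rewrite (count_blocks (moved_max x y))// -/(block_end x y l).
have [sl|sl] /= := boolP (block_end x y l); last first.
  rewrite mulr0 (prod0 _ i) ?mulr0//.
  by apply: contraNneq sl => <-.
have -> : hl_rate x y l = (gap x l)%:R.
  by move: sl; rewrite /hl_rate /block_end => /andP[-> /negbTE ->].
congr (_ * _); case: allP => [H|/allP/allPn[j]].
  rewrite big_nat_cond big1// => j /andP[jm jl].
  have := H j; rewrite mem_iota add1n => /(_ jm).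
  by rewrite (negbTE jl) /= -/(block_end x y j) => ->.
rewrite mem_iota add1n ltnS negb_or negbK => jm /andP[jl sj].
by rewrite (prod0 _ j).
Qed.

Lemma HL_generator x y :
  (HL_transition (1 - e) x y - (x == y)%:R) / e @[e --> 0^'+] -->
  (cont_generator x y : R).
Proof.
under eq_fun do rewrite /HL_transition -/(one_step x y).
have [xy|xy] := boolP (one_step x y).
  have [<- <-] := HL_limit xy; exact: has_rderiv_HL.
have nxy : x == y = false.
  by apply/negbTE; apply: contraNneq xy => ->; exact: one_step_refl.
rewrite /cont_generator nxy cont_rate_notstep// subrr.
by under eq_fun do rewrite mul0r; exact: cvg_cst.
Qed.

Lemma HL_transition_ge0 e x y : 0 < e < 1 -> 0 <= HL_transition (1 - e) x y.
Proof.
move=> /andP[e0 e1]; rewrite /HL_transition -/(one_step x y).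
case: ifPn => // xy; rewrite HL_weightE//.
have t0 : 0 <= 1 - e by lra.
have t1 : 1 - e <= 1 by lra.
rewrite mulr_ge0 ?exprn_ge0 ?invr_ge0//; apply: prodr_ge0 => i _.
rewrite /hl_factor; case: ifP => _; last exact: exprn_ge0.
rewrite mulr_ge0 ?exprn_ge0//; case: ifP => // _.
by rewrite subr_ge0 exprn_ile1.
Qed.

(** Each pair [(i, j)] with a positive clock rate leads to exactly one
    configuration, and it is again bounded by [M]. *)
Lemma cont_generator_conservative M x : x \in bounded_configs M ->
  \sum_(y <- bounded_configs M) cont_generator x y = 0 :> R.
Proof.
move=> xM; have uF := bounded_configs_uniq (m := m) M.
have -> : \sum_(y <- bounded_configs M) cont_generator x y =
    - \sum_(1 <= i < m.+1) clock_rate x i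
    + \sum_(y <- bounded_configs M) cont_rate x y :> R.
  rewrite (bigD1_seq x)//= [in RHS](bigD1_seq x)//= cont_rate_refl add0r.
  rewrite {1}/cont_generator eqxx; congr (_ + _); apply: eq_bigr => y yx.
  by rewrite /cont_generator eq_sym (negbTE yx).
rewrite [X in _ + X](eq_bigr _ (fun y _ => cont_rateE x y)).
rewrite exchange_big/= -sumrN -big_split/= big_nat big1// => i im.
rewrite -mulr_sumr -natr_sum clock_rateE//.
have [->|g0] := eqVneq (gap x i) 0%N; first by rewrite mulr0 mul0r oppr0 addr0.
rewrite exchange_big/=.
rewrite (_ : (\sum_(1 <= j < i.+1) _)%N = i); first by rewrite mulrC addNr.
rewrite -[RHS]/(i.+1.-1) -subn1 -[RHS]muln1 -sum_nat_const_nat.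
apply: eq_big_nat => j ji.
have [|||y yM xy] := @block_jump_exists m M x i j _ _ _ xM => //.
- by lia.
- by rewrite gapE//; lia.
rewrite (bigD1_seq y)//= xy big1// => z zy.
apply/eqP; rewrite eqb0; apply: contra zy => xz.
by rewrite (block_jump_unique xz xy).
Qed.

Lemma HL_closed (a : seq (config m)) : exists F : seq (config m),
  [/\ uniq F, {subset a <= F},
      forall e x y, 0 < e < 1 -> x \in F -> y \notin F ->
        HL_transition (1 - e) x y = 0 &
      {in F, forall x, \sum_(y <- F) cont_generator x y = 0 :> R}].
Proof.
have [M aM] := bounded_configs_cover a.
exists (bounded_configs M); split => //.
- exact: bounded_configs_uniq.
- move=> e x y _ xM yM; rewrite /HL_transition -/(one_step x y) ifN//.
  by apply: contra yM => xy; exact: one_step_bounded xM.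
- exact: cont_generator_conservative.
Qed.

End HallLittlewood.

Theorem proposition4p5 (R : realType) (m : nat) (hm : (1 <= m)%N)
  (d : R -> measure_display) (T : forall eps : R, measurableType (d eps))
  (P : forall eps : R, probability (T eps) R)
  (X : forall eps : R, nat -> T eps -> config m)
  (hX : forall eps : R, 0 < eps < 1 ->
     is_markov_chain (HL_transition (1 - eps)) (P eps) (X eps))
  (d' : measure_display) (T' : measurableType d') (P' : probability T' R)
  (Y : R -> T' -> config m)
  (hY : is_markov_jump_process cont_generator P' Y)
  (h0 : forall eps : R, 0 < eps < 1 -> forall x : config m,
     P eps [set w | X eps 0%N w = x] = P' [set w | Y 0 w = x])
  (k : nat) (tau : 'I_k -> R) (htau0 : forall j, 0 <= tau j)
  (htau : forall i j : 'I_k, (i <= j)%N -> tau i <= tau j)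
  (A : set ('I_k -> config m)) :
  P eps [set w | A (fun j => X eps (Num.truncn (eps^-1 * tau j)) w)]
    @[eps --> 0^'+] -->
  P' [set w | A (fun j => Y (tau j) w)].
Proof.
apply: (@poisson_limit R (config m) (fun e => HL_transition (1 - e))
  cont_generator _ _ _ d T P X d' T' P' Y hX hY h0 k tau A) => //.
- exact: HL_closed.
- by move=> e x y; exact: HL_transition_ge0.
- exact: HL_generator.
Qed.
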